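(* Let $G$ be a group (not necessarily finite), $H,K\leq G$ subgroups and $X\subseteq G$ a subset. Then the following statements are equivalent: (a) $X$ is a complete set of representatives of double cosets of $(H,K)$ in $G$; (b) $G=H\dot{X}K$, i.e. $G=HXK$ and the product $HXK$ is middle direct; (c) the product $HXK$ is middle direct, and $X$ is maximal relative to the middle direct product, i.e. for every $S\subseteq G$ with $X\subsetneq S$ the product $HSK$ is not middle direct.
   Context: For subsets $A,X,B$ of a group $G$, $AXB=\{axb: a\in A,x\in X,b\in B\}$. The product $AXB$ is called middle direct (and is then denoted $A\dot{X}B$) if for all $a,a'\in A$, $x,x'\in X$, $b,b'\in B$, the equality $axb=a'x'b'$ implies $x=x'$. A complete set of representatives of double cosets of $(H,K)$ in $G$ is a subset $X\subseteq G$ containing exactly one element of each double coset $HgK$, $g\in G$. *)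

(* Defs.v *)
From mathcomp Require Import all_boot.
From mathcomp Require Import boolp classical_sets.

Set Implicit Arguments.
Unset Strict Implicit.
Unset Printing Implicit Defensive.

Local Open Scope classical_set_scope.
Local Open Scope group_scope.

Definition set_prod3 (G : groupType) (A X B : set G) : set G :=
  [set g | exists a x b, [/\ A a, X x, B b & g = a * x * b]].

Definition middle_direct (G : groupType) (A X B : set G) : Prop :=
  forall a a' x x' b b', A a -> A a' -> X x -> X x' -> B b -> B b' ->
    a * x * b = a' * x' * b' -> x = x'.

Definition double_coset (G : groupType) (H : set G) (g : G) (K : set G) :
  set G := set_prod3 H [set g] K.

Definition double_coset_reps (G : groupType) (H K X : set G) : Prop :=
  forall g, exists! x, (X `&` double_coset H g K) x.

(* Main.v *)
(** Lying in the same [(H, K)]-double coset is an equivalence relation. In terms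
    of it, middle directness of [HXK] says that distinct elements of [X] lie in
    distinct double cosets, and [G = HXK] says that [X] meets every double coset.
    An element whose double coset misses [X] can be added to [X] without losing
    middle directness, so maximality amounts to [G = HXK]. *)
Require Import Defs.
From mathcomp Require Import all_boot.
From mathcomp Require Import boolp classical_sets.

Set Implicit Arguments.
Unset Strict Implicit.
Unset Printing Implicit Defensive.

Local Open Scope classical_set_scope.
Local Open Scope group_scope.

Section GroupClosedSet.
Variables (G : groupType) (H : set G).
Hypothesis gH : group_closed [in H].

Lemma group_closed_set1 : H 1.
Proof. by case: gH => /set_mem. Qed.

Lemma group_closed_setV h : H h -> H h^-1.
Proof. by move=> Hh; apply/set_mem/(group_closedV gH)/mem_set. Qed.

Lemma group_closed_setM h h' : H h -> H h' -> H (h * h').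
Proof.
by move=> Hh Hh'; apply/set_mem/(group_closedM gH); apply/mem_set.
Qed.

End GroupClosedSet.

Lemma double_cosetP (G : groupType) (H K : set G) g x :
  double_coset H g K x <-> exists h k, [/\ H h, K k & x = h * g * k].
Proof.
split=> [[h [_ [k [Hh -> Kk ->]]]]|[h [k [Hh Kk ->]]]]; first by exists h, k.
by exists h, g, k.
Qed.

Section DoubleCosets.
Variables (G : groupType) (H K : set G).
Hypotheses (gH : group_closed [in H]) (gK : group_closed [in K]).

Lemma double_coset_refl g : double_coset H g K g.
Proof.
apply/double_cosetP; exists 1, 1; rewrite mul1g mulg1.
by split=> //; exact: group_closed_set1.
Qed.

Lemma double_coset_sym g x : double_coset H g K x -> double_coset H x K g.
Proof.
move=> /double_cosetP[h [k [Hh Kk ->]]]; apply/double_cosetP.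
exists h^-1, k^-1; split; [exact: group_closed_setV..|].
by rewrite !mulgA mulVg mul1g mulgK.
Qed.

Lemma double_coset_trans g x y :
  double_coset H g K x -> double_coset H x K y -> double_coset H g K y.
Proof.
move=> /double_cosetP[h [k [Hh Kk ->]]] /double_cosetP[h' [k' [Hh' Kk' ->]]].
apply/double_cosetP; exists (h' * h), (k * k').
by split; [exact: group_closed_setM..|rewrite !mulgA].
Qed.

(** Solving [g = h * x * k] for [x] moves the subgroup factors to the side of [g], so membership
    takes the form used in [double_coset_reps]. *)
Lemma set_prod3P X g :
  set_prod3 H X K g <-> exists2 x, X x & double_coset H g K x.
Proof.
split=> [[h [x [k [Hh Xx Kk gE]]]]|[x Xx /double_coset_sym]].
  by exists x => //; apply/double_coset_sym/double_cosetP; exists h, k.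
by move=> /double_cosetP[h [k [Hh Kk gE]]]; exists h, x, k.
Qed.

(** An equality of two products puts both middle factors in the double coset of the common value.
    Conversely, [x' = h * x * k] is such an equality with trivial outer factors on the side of
    [x']. *)
Lemma middle_directP X :
  middle_direct H X K <->
  forall x x', X x -> X x' -> double_coset H x K x' -> x = x'.
Proof.
split=> [mX x x' Xx Xx' /double_cosetP[h [k [Hh Kk x'E]]]|mX].
  apply: (mX h 1 x x' k 1) => //; [exact: group_closed_set1..|].
  by rewrite mul1g mulg1.
move=> h h' x x' k k' Hh Hh' Xx Xx' Kk Kk' e.
apply: mX => //; apply: (@double_coset_trans _ (h * x * k)).
  by apply/double_cosetP; exists h, k.
by apply/double_coset_sym/double_cosetP; exists h', k'.
Qed.

(** A new coincidence would have to pair [g] with some element of [X], which would place [g] in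
    [HXK]. *)
Lemma middle_directU1 X g :
  middle_direct H X K -> ~ set_prod3 H X K g -> middle_direct H (g |` X) K.
Proof.
move=> /middle_directP mX gNX; apply/middle_directP => x x' [->|Xx] [->|Xx'] //.
- by move=> gx'; case: gNX; apply/set_prod3P; exists x'.
- by move=> /double_coset_sym gx; case: gNX; apply/set_prod3P; exists x.
- exact: mX.
Qed.

Lemma sub_set_prod3 X : X `<=` set_prod3 H X K.
Proof. by move=> x Xx; apply/set_prod3P; exists x => //; exact: double_coset_refl. Qed.

End DoubleCosets.

Theorem lemma2p2 (G : groupType) (H K X : set G)
    (gH : group_closed [in H]) (gK : group_closed [in K]) :
  [<-> double_coset_reps H K X;
       [set: G] = set_prod3 H X K /\ middle_direct H X K;
       middle_direct H X K /\
         (forall S : set G, X `<` S -> ~ middle_direct H S K)].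
Proof.
split=> [repX|]; last split=> [[GE mX]|[mX maxX]].
- split.
    apply/esym/seteqP; split=> // g _; apply/set_prod3P => //.
    by have [x [[Xx gx] _]] := repX g; exists x.
  apply/middle_directP => // x x' Xx Xx' xx'.
  (* Both [x] and [x'] represent the double coset of [x], so each equals its unique representative
     [y]. *)
  have [y [_ yP]] := repX x.
  rewrite -(yP x); last by split=> //; exact: double_coset_refl.
  exact: yP.
- split=> // S [XS SNX] /middle_directP mS; apply: SNX => s Ss.
  (* The double coset of [s] already meets [X] in some [x]; as [x] is also in [S], middle directness
     of [S] forces [s = x]. *)
  have /set_prod3P[//|//|x Xx sx] : set_prod3 H X K s by rewrite -GE.
  by rewrite (mS gH gK s x Ss (XS _ Xx) sx).
- move=> g.
  have /set_prod3P[//|//|x Xx gx] : set_prod3 H X K g.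
    apply: contrapT => gNX; apply: (maxX (g |` X)); last exact: middle_directU1.
    split=> [x Xx|gXX]; first by right.
    (* The extension is strict: [g] in [X] would already give [g] in [HXK]. *)
    by apply: gNX; apply: sub_set_prod3 => //; apply: gXX; left.
  exists x; split=> // x' [Xx' gx'].
  move/middle_directP: mX; apply=> //.
  exact: double_coset_trans (double_coset_sym gH gK gx) gx'.
Qed.
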